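(* Let $\boldsymbol X\in\mathbb{C}^{N\times N}$ be a (Hermitian) positive semidefinite matrix with $\operatorname{Tr}(\boldsymbol X)>0$. Then $$\operatorname{rank}(\boldsymbol X)=1\iff \|\boldsymbol X\|_*-\|\boldsymbol X\|_2=0 .$$
   Context: $\|\boldsymbol X\|_*$ denotes the nuclear norm (sum of the singular values) and $\|\boldsymbol X\|_2$ the spectral norm (largest singular value). *)

(* Defs.v *)
From HB Require Import structures.
From mathcomp Require Import all_boot all_order all_algebra.
From mathcomp Require Import complex.
From mathcomp Require Import reals.

Set Implicit Arguments.
Unset Strict Implicit.
Unset Printing Implicit Defensive.

Import Order.TTheory GRing.Theory Num.Theory.
Local Open Scope ring_scope.
Local Open Scope complex_scope.
Local Open Scope sesquilinear_scope.

(* In R[i], 0 <= z means that z is real and nonnegative. *)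
Definition psdmx (R : realType) (n : nat) (X : 'M[R[i]]_n) : Prop :=
  X \is hermsymmx /\ forall v : 'cV[R[i]]_n, 0 <= (v ^t* *m X *m v) 0 0.

(* Square roots of the eigenvalues, counted with multiplicity, of the Hermitian
   matrix X^* X.  These eigenvalues are nonnegative reals stored in R[i]; Re only
   casts them to R.  When m < n the n - m superfluous values are zero. *)
Definition singular_value (R : realType) (m n : nat) (X : 'M[R[i]]_(m, n))
    (i : 'I_n) : R :=
  Num.sqrt (complex.Re (spectral_diag (X ^t* *m X) 0 i)).

Definition nuclear_norm (R : realType) (m n : nat) (X : 'M[R[i]]_(m, n)) : R :=
  \sum_(i < n) singular_value X i.

(* The default value 0 of the maximum is harmless: singular values are >= 0. *)
Definition spectral_norm (R : realType) (m n : nat) (X : 'M[R[i]]_(m, n)) : R :=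
  \big[Num.max/0]_(i < n) singular_value X i.

(* Main.v *)
Require Import Defs.
From HB Require Import structures.
From mathcomp Require Import all_boot all_order all_algebra.
From mathcomp Require Import complex.
From mathcomp Require Import reals.
From mathcomp Require Import zify.

Set Implicit Arguments.
Unset Strict Implicit.
Unset Printing Implicit Defensive.

Import Order.TTheory GRing.Theory Num.Theory.
Local Open Scope ring_scope.
Local Open Scope complex_scope.

(* The number of nonzero singular values of X is the rank of X^* X, which equals
   the rank of X since X^* X and X have the same kernel.  The sum of nonnegative
   numbers equals their maximum exactly when at most one of them is nonzero, and
   positivity of the trace excludes X = 0. *)

Section GramMatrix.
Local Open Scope sesquilinear_scope.

(** The row space is the direct sum of the coordinate lines whose diagonal entry is nonzero. *)
Lemma rank_diag_mx (F : fieldType) (n : nat) (d : 'rV[F]_n) :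
  \rank (diag_mx d) = #|[set i | d 0 i != 0]|.
Proof.
have -> : \rank (diag_mx d)
    = \rank (\sum_(i | d 0%R i != 0%R) <<delta_mx 0%R i : 'rV[F]_n>>)%MS.
  apply/eqmx_rank/andP; split.
    apply/row_subP => i; rewrite row_diag_mx.
    have [->|di] := eqVneq (d 0 i) 0; first by rewrite scale0r sub0mx.
    by rewrite scalemx_sub // (sumsmx_sup i) // genmxE.
  apply/sumsmx_subP => i di; rewrite genmxE.
  have -> : delta_mx 0 i = (d 0 i)^-1 *: row i (diag_mx d).
    by rewrite row_diag_mx scalerA mulVf // scale1r.
  by rewrite scalemx_sub // row_sub.
(* The sum of coordinate lines is direct, so its rank is a sum of ones. *)
have /mxdirectP /= -> := @mxdirect_delta F _ (fun i => d 0 i != 0) n id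
  (in2W (fun _ _ => id)).
rewrite -sum1_card; apply: eq_big => [i|i _]; first by rewrite inE.
by rewrite mxrank_gen mxrank_delta.
Qed.

Lemma rank_gram (C : numClosedFieldType) (m n : nat) (X : 'M[C]_(m, n)) :
  \rank (X ^t* *m X) = \rank X.
Proof.
have kerX : (kermx (X ^t* *m X) <= kermx (X ^t*))%MS.
  apply/sub_kermxP/row_matrixP => i; rewrite row0 row_mul.
  set u := row i _.
  have uG : u *m (X ^t* *m X) = 0 by apply/sub_kermxP; rewrite row_sub.
  (* The squared norm of [u X^*] is [u (X^* X) u^*], which vanishes by [uG]. *)
  apply/eqP; rewrite -(dnorm_eq0 (@dotmx C m)); apply/eqP.
  rewrite [LHS]dotmxE trmx_mul map_mxM trmxCK !mulmxA.
  by rewrite -(mulmxA u) uG mul0mx mxE.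
apply/eqP; rewrite eqn_leq mxrankM_maxr /=.
have := mxrankS kerX; rewrite !mxrank_ker mxrank_map mxrank_tr.
(* The kernel ranks are truncated differences from [n]; the rank bounds make them exact. *)
by have := rank_leq_col X; have := rank_leq_row (X ^t* *m X); lia.
Qed.

Lemma normal_gram (C : numClosedFieldType) (m n : nat) (X : 'M[C]_(m, n)) :
  X ^t* *m X \is normalmx.
Proof. by apply/normalmxP; rewrite trmx_mul map_mxM trmxCK. Qed.

Lemma spectral_diag_gram_ge0 (C : numClosedFieldType) (m n : nat)
    (X : 'M[C]_(m, n)) (i : 'I_n) : 0 <= spectral_diag (X ^t* *m X) 0 i.
Proof.
set G := X ^t* *m X; set P := spectralmx G.
have Punit : P \in unitmx := spectral_unit G.
have /orthomx_spectralP GE : G \is normalmx := normal_gram X.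
have -> : spectral_diag G 0 i = (P *m X ^t* *m (P *m X ^t*) ^t*) i i.
  rewrite trmx_mul map_mxM trmxCK mulmxA -(mulmxA P) -/G.
  rewrite [in RHS]GE -/P -invmx_unitary ?spectral_unitarymx // -/P.
  by rewrite !mulmxA mulmxV // mul1mx mulmxK // mxE eqxx mulr1n.
by rewrite mxE sumr_ge0 // => k _; rewrite !mxE mul_conjC_ge0.
Qed.

(** The Gram matrix is normal, hence similar to the diagonal matrix of its eigenvalues, and
    invertible factors preserve rank. *)
Lemma rank_spectral_diag_gram (C : numClosedFieldType) (m n : nat)
    (X : 'M[C]_(m, n)) :
  \rank X = #|[set i | spectral_diag (X ^t* *m X) 0 i != 0]|.
Proof.
rewrite -rank_diag_mx -rank_gram; set G := X ^t* *m X.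
have /orthomx_spectralP GE : G \is normalmx := normal_gram X.
have Punit := spectral_unit G.
rewrite {1}GE mxrankMfree ?row_free_unit //.
by rewrite (eqmxMfull _ _) // row_full_unit unitmx_inv.
Qed.

(** Since the eigenvalue is real and nonnegative, neither [Re] nor [Num.sqrt], which sends negative
    numbers to 0, creates a spurious zero. *)
Lemma singular_value_eq0 (R : realType) (m n : nat) (X : 'M[R[i]]_(m, n))
    (i : 'I_n) :
  (singular_value X i == 0) = (spectral_diag (X ^t* *m X) 0 i == 0).
Proof.
have := spectral_diag_gram_ge0 X i; rewrite /singular_value.
case: (spectral_diag _ _ _) => a b; rewrite lecE /= => /andP[/eqP -> a_ge0].
by rewrite sqrtr_eq0 eq_complex /= eqxx andbT eq_le a_ge0 andbT.
Qed.

End GramMatrix.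

Lemma rank_singular_value (R : realType) (m n : nat) (X : 'M[R[i]]_(m, n)) :
  \rank X = #|[set i | singular_value X i != 0]|.
Proof.
rewrite rank_spectral_diag_gram; apply: eq_card => i.
by rewrite !inE singular_value_eq0.
Qed.

Lemma card_support_eq1 (R : realDomainType) (I : finType) (s : I -> R) :
  (forall i, 0 <= s i) -> #|[set i | s i != 0%R]| != 0%N ->
  #|[set i | s i != 0%R]| = 1%N <-> \sum_i s i = \big[Num.max/0]_i s i.
Proof.
move=> s_ge0; rewrite cards_eq0 => /set0Pn[i0]; rewrite inE => si0.
(* The index [i0] shows that the index set is inhabited, so the maximum is attained at some [j]; the
   default 0 lies below every value. *)
have := @bigmax_eq_arg _ _ _ 0 i0 predT s isT (fun i _ => s_ge0 i).
case: arg_maxP => // j _ s_le ->; have {s_le}s_le i : s i <= s j by apply: s_le.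
have sj : s j != 0.
  apply: contra_neq si0 => sj0; apply/eqP.
  by rewrite eq_le s_ge0 andbT -sj0 s_le.
rewrite (bigD1 j) //=; split=> [/eqP/cards1P[k suppE]|sumE].
  have kE i : s i != 0 -> i = k.
    by move=> si; apply/set1P; rewrite -suppE inE.
  rewrite big1 ?addr0 // => i; apply: contraNeq => /kE ->.
  by rewrite (kE j sj).
(* Cancelling the maximal term [s j] leaves nonnegative terms with sum zero, so each of them
   vanishes. *)
have {sumE}sum0 : \sum_(i | i != j) s i == 0.
  by rewrite -(inj_eq (addrI (s j))) addr0 sumE.
apply/eqP/cards1P; exists j; apply/setP => i; rewrite !inE.
have [->//|ij] := eqVneq i j.
apply/negbTE; rewrite negbK.
move: sum0; rewrite psumr_eq0 // => /allP/(_ i).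
by rewrite mem_index_enum ij; apply.
Qed.

Theorem proposition1 (R : realType) (N : nat) (X : 'M[R[i]]_N)
    (hX : psdmx X) (htr : 0 < \tr X) :
  \rank X = 1%N <-> nuclear_norm X - spectral_norm X = 0.
Proof.
(* A matrix of rank zero is the zero matrix, whose trace is not positive. *)
have rkX : \rank X != 0%N.
  apply: contraTneq htr => /eqP; rewrite mxrank_eq0 => /eqP ->.
  by rewrite mxtrace0 ltxx.
rewrite rank_singular_value in rkX *.
rewrite card_support_eq1 // => [|i]; last exact: sqrtr_ge0.
by split=> [sumE|/subr0_eq]; rewrite ?/nuclear_norm ?sumE ?subrr.
Qed.
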